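(* Let $H$ be a bipartite graph with parts $U_1$ and $U_2$, $n$ vertices and maximum degree at most $d \geq 2$. If $\epsilon>0$ and $G=(V_1,V_2;E)$ is a bipartite graph with $|V_1|=|V_2|=N \geq 16d\epsilon^{-d}n$ and at least $\epsilon N^2$ edges, then $G$ contains at least $(32d)^{-n/2}\epsilon^{dn}N^n$ labeled copies of $H$.
   Context: $G=(V_1,V_2;E)$ denotes a bipartite graph with parts $V_1,V_2$ and edge set $E$. A labeled copy of $H$ in $G$ is an injective map from the vertex set of $H$ to the vertex set of $G$ that maps every edge of $H$ to an edge of $G$. *)

(* Defs.v *)
From mathcomp Require Import all_boot all_order all_algebra.
From mathcomp Require Import reals exp.

Set Implicit Arguments.
Unset Strict Implicit.
Unset Printing Implicit Defensive.

Record sgraph := SGraph {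
  vertex :> finType;
  adj : rel vertex;
  adj_sym : symmetric adj;
  adj_irrefl : irreflexive adj
}.

Definition edges (G : sgraph) : {set {set G}} :=
  [set e | [exists x : G, exists y : G, adj x y && (e == [set x; y])]].

Definition degree (G : sgraph) (x : G) : nat := #|[set y : G | adj x y]|.

Definition max_degree (G : sgraph) : nat := \max_(x : G) degree x.

(* A part may be empty. *)
Definition bipartition (G : sgraph) (A B : {set G}) : Prop :=
  [/\ A :|: B = [set: G],
      [disjoint A & B] &
      forall x y : G, adj x y ->
        (x \in A /\ y \in B) \/ (x \in B /\ y \in A)].

(* A labeled copy need not respect given bipartitions of H and G. *)
Definition labeled_copies (H G : sgraph) : {set {ffun H -> G}} :=
  [set f : {ffun H -> G} | injectiveb f &&
    [forall x : H, forall y : H, adj x y ==> adj (f x) (f y)]].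

(* Main.v *)
Require Import Defs.
From mathcomp Require Import all_boot all_order all_algebra.
From mathcomp Require Import reals exp.
From mathcomp Require Import zify ring lra.

Set Implicit Arguments.
Unset Strict Implicit.
Unset Printing Implicit Defensive.

Import Order.TTheory GRing.Theory Num.Theory.

Local Open Scope ring_scope.

(** Dependent random choice. Put [D := eps ^+ d * N]. For a random [d]-tuple [t] of
    [V1] let [A] be its common neighbourhood in [V2]. Convexity gives that the
    mean of [#|A| ^ d] is at least [D ^+ d], while the mean number of [d]-tuples of
    [A] with fewer than [x := D / (4 d)] common neighbours is at most [x ^+ d], since
    such a tuple lies in [A] with probability less than [(x / N) ^+ d]. Hence some [A]
    has at least [D / 2] elements and fewer than [(#|A| / (2 d)) ^ d] bad tuples.
    If [U2] is the larger part, embed it greedily into [A], keeping for every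
    [u] in [U1] the image [s] of its embedded neighbours good, i.e. such that a
    fraction less than [(2 d) ^ - (d - size s)] of its extensions to [d]-tuples is
    bad. Each of the at most [d] neighbours of the current vertex forbids less
    than [#|A| / (2 d)] values, which leaves [#|A| / 2 - n >= 3 D / 16] choices. Then
    every vertex of [U1] has at least [x - n >= 3 D / (16 d)] choices, and
    [(3 / 16) ^+ 2 >= 1 / 32]. *)

(** * Convexity of powers *)

Lemma expr_ge_tangent (R : realFieldType) (a m : R) (k : nat) :
  0 <= a -> 0 <= m -> m ^+ k + k%:R * m ^+ k.-1 * (a - m) <= a ^+ k.
Proof.
move=> a0 m0; case: k => [|k]; first by rewrite !expr0 !mul0r addr0.
rewrite /=; elim: k => [|k IHk]; first by rewrite !expr1 expr0; lra.
rewrite [a ^+ _]exprS; apply: le_trans (ler_wpM2l a0 IHk).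
rewrite -subr_ge0 -[k.+2%:R]natr1 !exprS.
(* [a] times the bound for exponent [k.+1] exceeds the tangent for [k.+2] by a nonnegative multiple
   of a square. *)
have -> : a * (m * m ^+ k + k.+1%:R * m ^+ k * (a - m)) -
  (m * (m * m ^+ k) + (k.+1%:R + 1) * (m * m ^+ k) * (a - m)) =
  k.+1%:R * m ^+ k * (a - m) ^+ 2 by ring.
by rewrite mulr_ge0 ?sqr_ge0 ?mulr_ge0 ?exprn_ge0.
Qed.

(** Jensen's inequality by summing the tangents at [m]: the slope is nonnegative and [m] is at most
    the mean of [F], so the linear terms have nonnegative sum. *)
Lemma ler_sum_expr_mean (R : realFieldType) (I : finType) (P : {pred I})
    (F : I -> R) (m : R) (k : nat) :
    0 <= m -> (forall i, 0 <= F i) ->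
    #|P|%:R * m <= \sum_(i in P) F i ->
  #|P|%:R * m ^+ k <= \sum_(i in P) F i ^+ k.
Proof.
move=> m0 F0 leS.
apply: le_trans (ler_sum _ (fun i _ => expr_ge_tangent k (F0 i) m0)).
rewrite big_split /= -mulr_sumr sumrB !sumr_const mulr_natl lerDl.
by rewrite !mulr_ge0 ?ler0n ?exprn_ge0 // subr_ge0 -[leLHS]mulr_natl.
Qed.

(** * Counting functions built by greedy choice *)

Section GreedyCount.
Variables (R : realFieldType) (T S : finType) (s0 : S).

Definition ffun_upd (f : {ffun T -> S}) (v : T) (y : S) : {ffun T -> S} :=
  [ffun u => if u == v then y else f u].

Lemma ffun_updE f v y : ffun_upd f v y v = y.
Proof. by rewrite ffunE eqxx. Qed.

Lemma ffun_upd_neq f v y u : u != v -> ffun_upd f v y u = f u.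
Proof. by rewrite ffunE => /negbTE ->. Qed.

(** The last entry of [l] is processed first, and [inv p f] is the invariant once the suffix [p] has
    its values. At least [c v] values are available for [v] whatever was chosen before, so the
    choices multiply. *)
Lemma greedy_count (inv : seq T -> pred {ffun T -> S}) (c : T -> R)
    (l : seq T) :
    inv [::] [ffun=> s0] -> (forall v, 0 <= c v) -> uniq l ->
    (forall q v p f, l = q ++ v :: p -> inv p f ->
       c v <= #|[set y | inv (v :: p) (ffun_upd f v y)]|%:R) ->
  \prod_(v <- l) c v <= #|[set f | inv l f]|%:R.
Proof.
move=> inv0 c0 ul step.
(* A fixed value off the processed vertices makes (f, y) |-> f[v := y] injective. *)
pose Q p := [set f | inv p f && [forall u, (u \notin p) ==> (f u == s0)]].
suff HQ p q : l = q ++ p -> \prod_(v <- p) c v <= #|Q p|%:R.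
  apply: le_trans (HQ l [::] erefl) _; rewrite ler_nat subset_leq_card //.
  by apply/subsetP => f; rewrite !inE => /andP[].
elim: p q => [|v p IHp] q lE.
  rewrite big_nil ler1n card_gt0; apply/set0Pn; exists [ffun=> s0].
  by rewrite inE inv0; apply/forallP => u; rewrite ffunE eqxx implybT.
have vp : v \notin p.
  by move: ul; rewrite lE cat_uniq => /and3P[_ _ /=] /andP[].
pose E f := [set y | inv (v :: p) (ffun_upd f v y)].
pose D := [set fy : {ffun T -> S} * S | (fy.1 \in Q p) && (fy.2 \in E fy.1)].
have injD : {in D &, injective (fun fy => ffun_upd fy.1 v fy.2)}.
  move=> [f y] [g z]; rewrite !inE /= => /andP[/andP[_ /forallP f0] _].
  move=> /andP[/andP[_ /forallP g0] _] /ffunP fg.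
  congr pair; last by have := fg v; rewrite !ffun_updE.
  apply/ffunP => u; have [-> | uv] := eqVneq u v.
    by move: (f0 v) (g0 v); rewrite vp /= => /eqP -> /eqP ->.
  by have := fg u; rewrite !ffun_upd_neq.
have leD : (#|D| <= #|Q (v :: p)|)%N.
  rewrite -(card_in_imset injD) subset_leq_card //; apply/subsetP => h.
  case/imsetP => -[f y]; rewrite !inE /= => /andP[/andP[_ /forallP f0] invf] ->.
  rewrite invf /=; apply/forallP => u; apply/implyP.
  rewrite inE negb_or => /andP[uv up].
  by rewrite ffun_upd_neq //; move: (f0 u); rewrite up.
have cardD : #|D| = (\sum_(f in Q p) #|E f|)%N.
  rewrite -sum1_card.
  under [RHS]eq_bigr => f _ do rewrite -sum1_card.
  by rewrite pair_big_dep /=; apply: eq_bigl => -[f y]; rewrite inE.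
rewrite -(ler_nat R) cardD natr_sum in leD.
rewrite big_cons; apply: le_trans leD.
apply: (@le_trans _ _ (\sum_(f in Q p) c v)).
  rewrite sumr_const -[leRHS]mulr_natr ler_wpM2l //.
  by apply: (IHp (rcons q v)); rewrite cat_rcons.
apply: ler_sum => f; rewrite inE => /andP[invf _].
exact: (step q).
Qed.

End GreedyCount.

(** * Sequences with few bad extensions *)

Section BadExtensions.
Variables (T : finType) (A : {set T}) (bad : pred (seq T)).

(** Extensions may repeat entries, so there are [#|A| ^ k] in total and no falling factorials
    occur. *)
Fixpoint bad_ext (k : nat) (s : seq T) : nat :=
  if k is k'.+1 then (\sum_(v in A) bad_ext k' (v :: s))%N else bad s.

Hypothesis bad_cons : forall v s, bad s -> bad (v :: s).

Lemma bad_ext_bad k s : bad s -> bad_ext k s = (#|A| ^ k)%N.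
Proof.
elim: k s => [|k IHk] s bads /=; first by rewrite bads expn0.
under eq_bigr => v _ do rewrite (IHk (v :: s)) ?bad_cons //.
by rewrite sum_nat_const expnS.
Qed.

Variable d : nat.
Hypothesis d_gt0 : (0 < d)%N.

(** Denominators are cleared to stay in [nat]. Once [size s] reaches [d], the condition reads
    [bad s < 1], so [s] is not bad. *)
Definition good (s : seq T) : bool :=
  ((2 * d) ^ (d - size s) * bad_ext (d - size s) s < #|A| ^ (d - size s))%N.

(** All [#|A| ^ k] extensions of a bad sequence are bad, too many for [good]. *)
Lemma good_not_bad s : good s -> ~~ bad s.
Proof.
apply: contraL => bads; rewrite /good bad_ext_bad // -leqNgt.
by rewrite leq_pmull // expn_gt0 muln_gt0 d_gt0.
Qed.

(** Averaging over the next entry: with [k = d - size s - 1], each [v] that spoils goodness has at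
    least a fraction [(2 * d) ^ - k] of its extensions bad, while the fraction for [s] is below
    [(2 * d) ^ - k.+1]. *)
Lemma card_not_good_cons s : good s -> (size s < d)%N ->
  (#|[set v in A | ~~ good (v :: s)]| * (2 * d) < #|A|)%N.
Proof.
set B := [set _ in _ | _] => gs sd.
have [k dk] : exists k, (d - size s = k.+1)%N by exists (d - size s).-1; lia.
have dk' v : (d - size (v :: s) = k)%N by rewrite /=; lia.
move: gs; rewrite /good dk /= => lt_s.
have A0 : (0 < #|A|)%N.
  by case: #|A| lt_s => [|//]; rewrite exp0n.
have leB : (#|B| * #|A| ^ k <= (2 * d) ^ k * \sum_(v in A) bad_ext k (v :: s))%N.
  rewrite -sum_nat_const big_distrr /= [leqRHS](bigID (mem B)) /=.
  apply: leq_trans (leq_addr _ _).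
  rewrite [leqRHS](eq_bigl (mem B)); last first.
    by move=> v; rewrite !inE; case: (v \in A).
  apply: leq_sum => v; rewrite inE => /andP[_].
  by rewrite /good dk' -leqNgt.
rewrite -(ltn_pmul2r (m := #|A| ^ k)) ?expn_gt0 ?A0 // -expnS.
apply: leq_ltn_trans lt_s.
by rewrite expnS mulnAC -[leqRHS]mulnA mulnC leq_mul2l leB orbT.
Qed.

End BadExtensions.

(** * Dependent random choice *)

Definition common_nbrs (G : sgraph) (X : {set G}) (s : seq G) : {set G} :=
  [set y in X | all (adj y) s].

Section DependentRandomChoice.
Variables (R : realFieldType) (G : sgraph) (V1 V2 : {set G}) (d : nat).

Definition few_nbrs (x : R) (s : seq G) : bool :=
  #|common_nbrs V1 s|%:R < x.

Lemma few_nbrs_cons x v s : few_nbrs x s -> few_nbrs x (v :: s).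
Proof.
apply: le_lt_trans; rewrite ler_nat subset_leq_card //.
by apply/subsetP => y; rewrite !inE => /andP[-> /= /andP[_ ->]].
Qed.

Definition sample_nbrs (t : {ffun 'I_d -> G}) : {set G} :=
  [set y in V2 | [forall i, adj (t i) y]].

(** For a sample [t] in [V1], all entries of [s] lie in [sample_nbrs t] exactly when each of the [d]
    sampled vertices is a common neighbour of [s]. *)
Lemma card_samples (s : seq G) : all (mem V2) s ->
  #|[pred t in ffun_on (mem V1) | all (mem (sample_nbrs t)) s]| =
  (#|common_nbrs V1 s| ^ d)%N.
Proof.
move=> /allP sV2; rewrite -[d in RHS]card_ord -card_ffun_on; apply: eq_card => t.
rewrite !inE; apply/andP/ffun_onP => [[/ffun_onP tV1 /allP ts] i | ts].
  rewrite inE tV1; apply/allP => y ys.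
  by have : y \in sample_nbrs t := ts y ys; rewrite inE => /andP[_ /forallP].
split; first by apply/ffun_onP => i; have := ts i; rewrite inE => /andP[].
apply/allP => y ys; rewrite /= inE [y \in V2]sV2 //; apply/forallP => i.
by have := ts i; rewrite inE => /andP[_ /allP]; apply.
Qed.

(** Induction on [k], exchanging the sums over [t] and over the next entry [v]; the condition on [t]
    absorbs [v \in sample_nbrs t]. At [k = 0] a bad [s] has fewer than [x] common neighbours, so at
    most [x ^+ d] samples catch it. *)
Lemma sum_bad_ext_le (x : R) (k : nat) (s : seq G) :
    0 <= x -> all (mem V2) s ->
  \sum_(t in ffun_on (mem V1) | all (mem (sample_nbrs t)) s)
    (bad_ext (sample_nbrs t) (few_nbrs x) k s)%:R <= #|V2|%:R ^+ k * x ^+ d.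
Proof.
move=> x0; elim: k s => [|k IHk] s sV2.
  rewrite expr0 mul1r /= sumr_const card_samples //.
  case fs: (few_nbrs x s); last by rewrite mul0rn exprn_ge0.
  by rewrite natrX lerXn2r ?nnegrE // ltW.
pose F t v : R := (bad_ext (sample_nbrs t) (few_nbrs x) k (v :: s))%:R.
have -> : \sum_(t in ffun_on (mem V1) | all (mem (sample_nbrs t)) s)
    (bad_ext (sample_nbrs t) (few_nbrs x) k.+1 s)%:R =
  \sum_(v in V2)
    \sum_(t in ffun_on (mem V1) | all (mem (sample_nbrs t)) (v :: s)) F t v.
  under eq_bigr => t _ do rewrite /= natr_sum.
  rewrite (exchange_big_dep (mem V2)) /=; last first.
    by move=> t v _; rewrite inE => /andP[].
  by apply: eq_bigr => v vV2; apply: eq_bigl => t /=;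
    rewrite -!andbA [X in _ && X]andbC.
apply: (@le_trans _ _ (\sum_(v in V2) #|V2|%:R ^+ k * x ^+ d)).
  by apply: ler_sum => v vV2; apply: IHk; rewrite /= vV2.
by rewrite sumr_const -[leLHS]mulr_natl exprS mulrA.
Qed.

Lemma sum_card_sample_nbrs :
  (\sum_(t in ffun_on (mem V1)) #|sample_nbrs t| =
   \sum_(v in V2) #|common_nbrs V1 [:: v]| ^ d)%N.
Proof.
under eq_bigr => t _ do rewrite -sum1_card.
rewrite (exchange_big_dep (mem V2)) /=; last first.
  by move=> t v _; rewrite inE => /andP[].
apply: eq_bigr => v vV2; rewrite -card_samples /= ?vV2 //.
by rewrite sum1_card; apply: eq_card => t; rewrite !unfold_in /= andbT.
Qed.

Lemma dependent_random_choice (N : nat) (eps : R) :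
    (0 < d)%N -> (0 < N)%N -> 0 < eps -> #|V1| = N -> #|V2| = N ->
    eps * N%:R ^+ 2 <= \sum_(v in V2) #|common_nbrs V1 [:: v]|%:R ->
  let D := eps ^+ d * N%:R in
  exists A : {set G},
    [/\ A \subset V2, D / 2 <= #|A|%:R
      & good A (few_nbrs (D / (4 * d)%:R)) d [::]].
Proof.
move=> d0 N0 eps0 cV1 cV2 eE D.
have N0R : 0 < N%:R :> R by rewrite ltr0n.
have D0 : 0 < D by rewrite mulr_gt0 ?exprn_gt0.
have dR0 : 0 < d%:R :> R by rewrite ltr0n.
set x := D / (4 * d)%:R.
have x0 : 0 <= x by rewrite divr_ge0 ?(ltW D0).
set P := ffun_on (mem V1) : {pred {ffun 'I_d -> G}}.
have cP : #|P| = (N ^ d)%N by rewrite card_ffun_on card_ord cV1.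
(* Convexity is applied twice: here to the degrees over [V2], then to the sizes [#|sample_nbrs t|]
   over the samples. *)
have sumA : N%:R ^+ d * D <= \sum_(t in P) #|sample_nbrs t|%:R.
  rewrite -natr_sum sum_card_sample_nbrs natr_sum.
  under eq_bigr => v _ do rewrite natrX.
  have := @ler_sum_expr_mean R _ (mem V2) (fun v => #|common_nbrs V1 [:: v]|%:R)
            (eps * N%:R) d.
  rewrite cV2; move=> /(_ _ (fun=> ler0n _ _)) H.
  apply: le_trans (H _ _); last 2 first.
  - by rewrite mulr_ge0 ?ltW.
  - by apply: le_trans eE; rewrite expr2 mulrCA.
  by rewrite /D exprMn mulrCA [_ * N%:R]mulrC mulrCA.
have sumAd : N%:R ^+ d * D ^+ d <= \sum_(t in P) #|sample_nbrs t|%:R ^+ d.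
  have := @ler_sum_expr_mean R _ P (fun t => #|sample_nbrs t|%:R) D d.
  by rewrite cP natrX; apply=> //; exact: ltW.
pose w t := bad_ext (sample_nbrs t) (few_nbrs x) d [::].
have sumw : \sum_(t in P) (w t)%:R <= N%:R ^+ d * x ^+ d.
  have := @sum_bad_ext_le x d [::] x0 isT; rewrite cV2.
  by under eq_bigl => t do rewrite /= andbT.
(* Since [2 * d * x = D / 2], the mean over [t] of the right side is at least
   [D ^+ d - (D / 2) ^+ d], hence at least [(D / 2) ^+ d] because [2 <= 2 ^+ d]. A single such [t]
   gives both the size and the goodness. *)
have [t tP Ht] : exists2 t, t \in P &
    (D / 2) ^+ d <= #|sample_nbrs t|%:R ^+ d - (2 * d)%:R ^+ d * (w t)%:R.
  apply/exists_inP; rewrite -[X in is_true X]negbK negb_exists_in.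
  apply/negP => /forall_inP Hlt.
  have t0P : exists t, t \in P.
    by apply/card_gt0P; rewrite cP expn_gt0 N0.
  have : \sum_(t in P) (#|sample_nbrs t|%:R ^+ d - (2 * d)%:R ^+ d * (w t)%:R)
      < \sum_(t in P) (D / 2) ^+ d.
    apply: ltr_sum; last by move=> t /Hlt; rewrite -ltNge.
    by case: t0P => t tP; apply/hasP; exists t => //; rewrite mem_index_enum.
  rewrite sumr_const cP -[ltRHS]mulr_natl natrX sumrB -mulr_sumr ltNge => /negP.
  apply; rewrite lerBrDl.
  have xE : (2 * d)%:R ^+ d * x ^+ d = (D / 2) ^+ d.
    rewrite -exprMn; congr (_ ^+ _); rewrite /x !natrM; field.
    by rewrite gt_eqF.
  apply: le_trans sumAd.
  have -> : N%:R ^+ d * D ^+ d = N%:R ^+ d * (D / 2) ^+ d * 2 ^+ d.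
    by rewrite -mulrA -[(D / 2) ^+ d * _]exprMn divfK ?pnatr_eq0.
  apply: (@le_trans _ _ (N%:R ^+ d * (D / 2) ^+ d * 2)); last first.
    rewrite ler_wpM2l ?mulr_ge0 ?exprn_ge0 ?divr_ge0 ?(ltW D0) ?(ltW N0R) //.
    by rewrite ler_eXnr // ler1n.
  rewrite mulr_natr mulr2n lerD2r -xE mulrCA ler_wpM2l ?exprn_ge0 //.
have D20 : 0 < (D / 2) ^+ d by rewrite exprn_gt0 // divr_gt0.
exists (sample_nbrs t); split.
- by apply/subsetP => y; rewrite inE => /andP[].
- rewrite -(ler_pXn2r d0) ?nnegrE ?divr_ge0 ?(ltW D0) //.
  by apply: le_trans Ht _; rewrite gerBl mulr_ge0 ?exprn_ge0.
- rewrite /good subn0 -(ltr_nat R) natrM !natrX -subr_gt0.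
  exact: lt_le_trans Ht.
Qed.

End DependentRandomChoice.

(** * Greedy embedding of [H] *)

Lemma card_bigcup_le (I T : finType) (P : {pred I}) (F : I -> {set T}) :
  (#|\bigcup_(i in P) F i| <= \sum_(i in P) #|F i|)%N.
Proof.
elim/big_ind2: _ => [|m B n C leB leC|//]; first by rewrite cards0.
exact: leq_trans (leq_card_setU _ _) (leq_add leB leC).
Qed.

Lemma card_map_le (I T : finType) (f : I -> T) (p : seq I) :
  (#|[set y in map f p]| <= #|I|)%N.
Proof.
apply: leq_trans (leq_trans (leq_imset_card f (mem p)) (max_card _)).
apply/subset_leq_card/subsetP => y; rewrite inE => /mapP[v vp ->].
exact: imset_f.
Qed.

Section Embedding.
Variables (R : realFieldType) (H G : sgraph) (U1 U2 : {set H}).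
Variables (V1 A : {set G}) (d : nat) (x : R).
Hypothesis bipH : bipartition U1 U2.
Hypothesis d_gt0 : (0 < d)%N.
Hypothesis degH : (max_degree H <= d)%N.

Local Notation goodA := (good A (few_nbrs V1 x) d).

(** Filtering [p] in order makes placing a neighbour [v] of [u] prepend its image, as in
    [good (v :: s)]. *)
Definition nbr_images (f : {ffun H -> G}) (p : seq H) (u : H) : seq G :=
  [seq f v | v <- p & adj u v].

(** Goodness is kept for every [u] in [U1], placed or not. Adjacency is asked only of placed [u] in
    [U1], towards all neighbours [w]: this is void while [U2] is being placed, and afterwards every
    such [w] has its image. *)
Definition partial_copy (p : seq H) (f : {ffun H -> G}) : bool :=
  [&& uniq (map f p), [forall u in U1, goodA (nbr_images f p u)]
    & [forall u in U1, forall w, (u \in p) && adj u w ==> adj (f u) (f w)]].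

Lemma adj_U1 u w : u \in U1 -> adj u w -> w \in U2.
Proof.
case: bipH => _ dU ad uU1 /ad[[]//|[uU2 _]].
by rewrite (disjointFr dU uU1) in uU2.
Qed.

Lemma notin_U1 v : (v \in U1) = (v \notin U2).
Proof.
case: bipH => UT dU _; have : v \in U1 :|: U2 by rewrite UT inE.
rewrite inE; case vU1: (v \in U1) => /=; first by rewrite (disjointFr dU vU1).
by move=> ->.
Qed.

Lemma card_adj_le (u : H) : (#|[set v | adj u v]| <= d)%N.
Proof. by apply: leq_trans degH; apply: (leq_bigmax u). Qed.

Lemma nbr_images_upd f p v y u : v \notin p ->
  nbr_images (ffun_upd f v y) (v :: p) u =
  if adj u v then y :: nbr_images f p u else nbr_images f p u.
Proof.
move=> vp; have E : [seq ffun_upd f v y w | w <- p & adj u w] = nbr_images f p u.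
  apply/eq_in_map => w; rewrite mem_filter => /andP[_ wp].
  by rewrite ffun_upd_neq //; apply: contraNneq vp => <-.
by rewrite /nbr_images /=; case: ifP => _ /=; rewrite E // ffun_updE.
Qed.

Lemma map_ffun_upd (f : {ffun H -> G}) p v y : v \notin p ->
  map (ffun_upd f v y) (v :: p) = y :: map f p.
Proof.
move=> vp /=; rewrite ffun_updE; congr cons; apply/eq_in_map => w wp.
by rewrite ffun_upd_neq //; apply: contraNneq vp => <-.
Qed.

(** [v] is one more neighbour of [u], outside [p], which makes the inequality strict as
    [card_not_good_cons] needs. *)
Lemma size_nbr_images f p v u : uniq (v :: p) -> adj u v ->
  (size (nbr_images f p u) < d)%N.
Proof.
move=> uvp uv; apply: leq_trans (card_adj_le u).
have -> : (size (nbr_images f p u)).+1 = size (filter (adj u) (v :: p)).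
  by rewrite /nbr_images size_map /= uv.
have /card_uniqP <- := filter_uniq (adj u) uvp.
by apply/subset_leq_card/subsetP => w; rewrite mem_filter !inE => /andP[].
Qed.

(** A value of [A] is excluded if already used, or if it spoils goodness for one of the at most [d]
    neighbours of [v]; each neighbour excludes fewer than [#|A| / (2 * d)] values, together at most
    half of [A]. *)
Lemma card_extend_U2 f p v :
    uniq (v :: p) -> v \in U2 -> {subset p <= U2} -> partial_copy p f ->
  (#|A| <= 2 * (#|[set y | partial_copy (v :: p) (ffun_upd f v y)]| + #|H|))%N.
Proof.
move=> uvp vU2 pU2 /and3P[uf /forall_inP gf /forall_inP af].
have vp : v \notin p by case/andP: uvp.
set E := [set y | _].
pose B u := [set y in A | ~~ goodA (y :: nbr_images f p u)].
pose P := [pred u in U1 | adj u v].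
have sub : A \subset E :|: [set y in map f p] :|: \bigcup_(u in P) B u.
  apply/subsetP => y yA; rewrite !in_setU.
  case yp: (y \in [set y in map f p]); first by rewrite orbT.
  rewrite inE in yp.
  case yB: (y \in \bigcup_(u in P) B u); first by rewrite !orbT.
  rewrite !orbF inE; apply/and3P; split.
  - by rewrite map_ffun_upd //= yp uf.
  - apply/forall_inP => u uU1; rewrite nbr_images_upd //.
    case: ifP => uv; last exact: gf.
    apply: contraFT yB => ng; apply/bigcupP; exists u; rewrite inE ?uU1 //.
    by rewrite yA.
  (* Void: all of [v :: p] lies in [U2], so no vertex of [U1] is placed. *)
  apply/forall_inP => u; rewrite notin_U1 => uU2; apply/forallP => w.
  apply/implyP => /andP[]; rewrite inE => /predU1P[uv|/pU2 uin] _.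
    by rewrite uv vU2 in uU2.
  by rewrite uin in uU2.
have cP : (#|P| <= d)%N.
  apply: leq_trans (card_adj_le v); apply/subset_leq_card/subsetP => u.
  by rewrite !inE adj_sym => /andP[].
have cB : ((\sum_(u in P) #|B u|) * 2 <= #|A|)%N.
  rewrite -(leq_pmul2r d_gt0) -mulnA big_distrl /=.
  apply: (@leq_trans (\sum_(u in P) #|A|)); last first.
    by rewrite sum_nat_const mulnC leq_mul2l cP orbT.
  apply: leq_sum => u /andP[uU1 uv]; apply: ltnW.
  apply: card_not_good_cons => //; first exact: gf.
  exact: size_nbr_images uv.
have cp := card_map_le f p.
have arith a e h m b : (m <= h -> b * 2 <= a -> a <= e + m + b ->
  a <= 2 * (e + h))%N by lia.
apply: arith cp cB _; apply: leq_trans (subset_leq_card sub) _.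
apply: leq_trans (leq_card_setU _ _) _.
by rewrite leq_add ?card_bigcup_le // leq_card_setU.
Qed.

(** With [U2] placed, the images of all neighbours of [v] form a good, hence not bad, list; its
    common neighbours, at least [x] of them, are admissible unless already used. *)
Lemma card_extend_U1 f p v :
    uniq (v :: p) -> v \in U1 -> {subset U2 <= p} -> partial_copy p f ->
  x <= (#|[set y | partial_copy (v :: p) (ffun_upd f v y)]| + #|H|)%:R.
Proof.
move=> uvp vU1 U2p /and3P[uf /forall_inP gf /forall_inP af].
have vp : v \notin p by case/andP: uvp.
set E := [set y | _].
have := good_not_bad (@few_nbrs_cons _ _ _ _) d_gt0 (gf v vU1).
rewrite /few_nbrs -leNgt => /le_trans; apply; rewrite ler_nat.
have cp := card_map_le f p.
apply: leq_trans (leq_add (leqnn _) cp); apply: leq_trans (leq_card_setU _ _).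
apply/subset_leq_card/subsetP => y; rewrite inE => /andP[_ /allP ynb].
rewrite in_setU; case yp: (y \in [set y in map f p]); first by rewrite orbT.
rewrite inE in yp; rewrite orbF inE; apply/and3P; split.
- by rewrite map_ffun_upd //= yp uf.
(* No vertex of [U1] is adjacent to [v], so the goodness lists do not change. *)
- apply/forall_inP => u uU1; rewrite nbr_images_upd //; case: ifP => [uv|_].
    by have := adj_U1 uU1 uv; rewrite notin_U1 in vU1; rewrite (negbTE vU1).
  exact: gf.
apply/forall_inP => u uU1; apply/forallP => w; apply/implyP => /andP[uin uw].
have wU2 := adj_U1 uU1 uw.
have wv : w != v by apply: contraTneq wU2 => ->; rewrite -notin_U1.
rewrite (ffun_upd_neq _ _ wv).
have [uv|uv] := eqVneq u v.
  rewrite uv ffun_updE; apply: ynb; apply: map_f.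
  by rewrite mem_filter -uv uw U2p.
rewrite ffun_upd_neq //; move: uin; rewrite inE (negbTE uv) /= => up.
by have /forallP/(_ w) := af u uU1; rewrite up uw.
Qed.

Lemma partial_copy_all f : partial_copy (enum U1 ++ enum U2) f ->
  f \in labeled_copies H G.
Proof.
case/and3P => uf _ /forall_inP af; rewrite inE; apply/andP; split.
  rewrite /injectiveb /dinjectiveb.
  rewrite -(perm_uniq (perm_map f (s := enum U1 ++ enum U2) _)) //.
  apply: uniq_perm; rewrite ?enum_uniq //; first exact: map_uniq uf.
  by move=> v; rewrite mem_cat !mem_enum notin_U1 inE orNb.
have adjU1 u w : u \in U1 -> adj u w -> adj (f u) (f w).
  move=> uU1 uw; have /forallP/(_ w) := af u uU1.
  by rewrite uw mem_cat mem_enum uU1.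
apply/forallP => u; apply/forallP => w; apply/implyP => uw.
case: bipH => _ _ /(_ u w uw) [[uU1 _]|[_ wU1]]; first exact: adjU1.
by rewrite adj_sym adjU1 // adj_sym.
Qed.

Lemma labeled_copies_ge (cA cB : R) :
    0 <= cA -> 0 <= cB -> goodA [::] ->
    cA <= #|A|%:R / 2 - #|H|%:R -> cB <= x - #|H|%:R ->
  cA ^+ #|U2| * cB ^+ #|U1| <= #|labeled_copies H G|%:R.
Proof.
move=> cA0 cB0 good0 cAle cBle.
(* As [d > 0], the strict inequality in [good [::]] forces [A] to be nonempty; [g0] is the default
   value for the greedy count. *)
have [g0 _] : exists g0, g0 \in A.
  apply/card_gt0P; move: good0; rewrite /good subn0.
  by case: #|A| => [|//]; rewrite exp0n.
pose c v := if v \in U2 then cA else cB.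
set l := enum U1 ++ enum U2.
have ul : uniq l.
  rewrite cat_uniq !enum_uniq andbT /= -all_predC; apply/allP => v.
  by rewrite !inE /= !mem_enum notin_U1 negbK.
(* The list is processed from its tail, so U2 is embedded before U1. *)
pose before u v := (u \in U2) ==> (v \in U2).
have ordl : pairwise before l.
  have allU2 s w : {subset s <= U2} -> all (before w) s.
    by move=> sU2; apply/allP => u /sU2 uU2; rewrite /before uU2 implybT.
  have pwU2 s : {subset s <= U2} -> pairwise before s.
    elim: s => //= w s IHs sU2; have sU2' : {subset s <= U2}.
      by move=> u us; apply: sU2; rewrite inE us orbT.
    by rewrite allU2 ?IHs.
  have pwU1 s : {subset s <= U1} -> pairwise before s.
    elim: s => //= w s IHs sU1; rewrite IHs ?andbT => [|u us]; last first.
      by apply: sU1; rewrite inE us orbT.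
    have := sU1 w (mem_head _ _); rewrite notin_U1 => /negbTE wU2.
    by apply/allP => u _; rewrite /before wU2.
  rewrite pairwise_cat pwU1 ?pwU2 ?andbT => [|u|u]; rewrite ?mem_enum //.
  by apply/allP => u _; apply: allU2 => w; rewrite mem_enum.
have -> : cA ^+ #|U2| * cB ^+ #|U1| = \prod_(v <- l) c v.
  rewrite big_cat !big_enum /= mulrC; congr (_ * _).
    rewrite -prodr_const; apply: eq_bigr => v.
    by rewrite notin_U1 /c => /negbTE ->.
  by rewrite -prodr_const; apply: eq_bigr => v; rewrite /c => ->.
apply: (@le_trans _ _ #|[set f | partial_copy l f]|%:R); last first.
  rewrite ler_nat subset_leq_card //; apply/subsetP => f; rewrite inE.
  exact: partial_copy_all.
apply: (greedy_count (s0 := g0)) => //.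
- rewrite /partial_copy /=; apply/andP; split; first exact/forall_inP.
  by apply/forall_inP => u _; apply/forallP.
- by move=> v; rewrite /c; case: ifP.
move=> q v p f lE pc.
have uvp : uniq (v :: p) by move: ul; rewrite lE cat_uniq => /and3P[].
move: ordl; rewrite lE pairwise_cat /= => /and3P[/allrelP qvp _ /andP[/allP vpw _]].
rewrite /c; case: ifPn => vU2.
  have pU2 : {subset p <= U2} by move=> w /vpw; rewrite /before vU2.
  have := card_extend_U2 uvp vU2 pU2 pc.
  by rewrite -(ler_nat R) natrM natrD; lra.
have U2p : {subset U2 <= p}.
  move=> w wU2; have : w \in l by rewrite mem_cat !mem_enum wU2 orbT.
  rewrite lE mem_cat inE => /or3P[wq|/eqP wv|//].
    by have := qvp w v wq (mem_head _ _); rewrite /before wU2 (negbTE vU2).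
  by rewrite -wv wU2 in vU2.
rewrite -notin_U1 in vU2.
by have := card_extend_U1 uvp vU2 U2p pc; rewrite natrD; lra.
Qed.

End Embedding.

(** * Edge count, numerical bounds and conclusion *)

Lemma card_edges_le (G : sgraph) (V1 V2 : {set G}) : bipartition V1 V2 ->
  (#|edges G| <= \sum_(v in V2) #|common_nbrs V1 [:: v]|)%N.
Proof.
case=> _ _ ad.
pose P := [set p : G * G | (p.1 \in V2) && (p.2 \in common_nbrs V1 [:: p.1])].
have -> : (\sum_(v in V2) #|common_nbrs V1 [:: v]| = #|P|)%N.
  rewrite -sum1_card; under eq_bigr => v _ do rewrite -sum1_card.
  by rewrite pair_big_dep /=; apply: eq_bigl => -[v u]; rewrite [RHS]inE.
(* Each edge is the set underlying a pair [(v, u)] with [v] in [V2] and [u] in [V1], and [P]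
   consists of these pairs. *)
apply: leq_trans (leq_imset_card (fun p => [set p.2; p.1]) P).
apply/subset_leq_card/subsetP => e; rewrite inE.
case/existsP => u /existsP[v /andP[uv /eqP ->]].
case: (ad u v uv) => -[uV vV]; apply/imsetP; [exists (v, u) | exists (u, v)] => //=.
- by rewrite !inE /= vV uV uv.
- by rewrite !inE /= vV uV adj_sym uv.
- by rewrite setUC.
Qed.

(** Each of the [k] factors [b] is paired with a factor [a], giving at least [r ^+ 2]; the other
    [m - k] factors are [a >= r]. Thus [b] may be smaller than [r], which is why the larger part
    goes into [A]. *)
Lemma ler_expr_balanced (R : realFieldType) (r a b : R) (k m : nat) :
    0 <= r -> r <= a -> r ^+ 2 <= a * b -> 0 <= b -> (k <= m)%N ->
  r ^+ (m + k) <= a ^+ m * b ^+ k.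
Proof.
move=> r0 ra rab b0 km; have a0 := le_trans r0 ra.
have -> : (m + k = (m - k) + 2 * k)%N by lia.
rewrite -[in leRHS](subnK km) 2!exprD exprM -mulrA -exprMn.
by rewrite ler_pM ?exprn_ge0 ?lerXn2r ?nnegrE ?mulr_ge0.
Qed.

Lemma powRN_half (R : realType) (c : R) (n : nat) : 0 <= c ->
  c `^ (- (n%:R / 2)) = (Num.sqrt c)^-1 ^+ n.
Proof.
move=> c0; rewrite powRN [n%:R / 2]mulrC powRrM powR12_sqrt //.
by rewrite powR_mulrn ?sqrtr_ge0 // exprVn.
Qed.

Lemma labeled_copies_large_U2 (R : realType) (n d N : nat) (eps : R)
    (H : sgraph) (U1 U2 : {set H}) (G : sgraph) (V1 V2 : {set G}) :
    bipartition U1 U2 -> #|H| = n -> (#|U1| <= #|U2|)%N ->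
    (2 <= d)%N -> (max_degree H <= d)%N -> 0 < eps ->
    bipartition V1 V2 -> #|V1| = N -> #|V2| = N ->
    (16 * d)%:R * eps ^- d * n%:R <= N%:R ->
    eps * N%:R ^+ 2 <= #|edges G|%:R -> (0 < n)%N ->
  (32 * d)%:R `^ (- (n%:R / 2)) * eps ^+ (d * n) * N%:R ^+ n
    <= #|labeled_copies H G|%:R.
Proof.
move=> bipH cH U12 d2 degH eps0 bipG cV1 cV2 leN leE n0.
have d0 : (0 < d)%N by exact: ltnW.
have dR : 2 <= d%:R :> R by rewrite ler_nat.
have nR : 1 <= n%:R :> R by rewrite ler1n.
have epsd : 0 < eps ^+ d by rewrite exprn_gt0.
pose D := eps ^+ d * N%:R.
have leD : (16 * d)%:R * n%:R <= D.
  rewrite /D -ler_pdivrMl //; apply: le_trans leN.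
  by rewrite mulrA [_^-1 * _]mulrC.
have D0 : 0 < D.
  by apply: lt_le_trans leD; rewrite mulr_gt0 ?ltr0n ?muln_gt0.
have N0 : (0 < N)%N by move: D0; rewrite /D pmulr_rgt0 // ltr0n.
have leE' : eps * N%:R ^+ 2 <= \sum_(v in V2) #|common_nbrs V1 [:: v]|%:R.
  by apply: le_trans leE _; rewrite -natr_sum ler_nat card_edges_le.
have [A [_ cA gA]] := dependent_random_choice d0 N0 eps0 cV1 cV2 leE'.
rewrite -/D in cA gA.
rewrite natrM in leD.
have leD32 : 32 * n%:R <= D.
  by apply: le_trans leD; rewrite ler_wpM2r //; lra.
(* [n] is at most a quarter of the threshold [D / (4 * d)], which leaves [3 * D / (16 * d)] choices
   for each vertex of [U1]. *)
have leDd : n%:R <= D / (16 * d%:R).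
  by rewrite ler_pdivlMr ?mulr_gt0 ?ltr0n // mulrC.
have ddD : D / (4 * d)%:R = 4 * (D / (16 * d%:R)).
  by rewrite natrM; field; rewrite gt_eqF ?ltr0n.
have dD3 : 3 / 16 / d%:R * D = 3 * (D / (16 * d%:R)).
  by field; rewrite gt_eqF ?ltr0n.
have := @labeled_copies_ge R H G U1 U2 V1 A d (D / (4 * d)%:R) bipH d0 degH
  (3 / 16 * D) (3 / 16 / d%:R * D).
have D0' := ltW D0.
move=> /(_ _ _ gA) Hc; apply: le_trans (Hc _ _ _ _).
- have -> : eps ^+ (d * n) = (eps ^+ d) ^+ n by rewrite exprM.
  rewrite -mulrA -exprMn -/D.
  have cU : n = (#|U2| + #|U1|)%N.
    case: bipH => UT dU _; rewrite addnC -cH -cardsT -UT.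
    by rewrite cardsU disjoint_setI0 // cards0 subn0.
  rewrite (exprMn _ (3 / 16)) (exprMn _ (3 / 16 / d%:R)) [leRHS]mulrACA.
  rewrite -exprD -cU ler_wpM2r ?exprn_ge0 //.
  rewrite powRN_half // cU.
  have s0 : 0 < Num.sqrt (32 * d)%:R :> R by rewrite sqrtr_gt0 ltr0n muln_gt0.
  have sE : (Num.sqrt (32 * d)%:R)^-1 ^+ 2 = (32 * d%:R)^-1 :> R.
    by rewrite exprVn sqr_sqrtr ?ler0n // natrM.
  (* Here [r ^+ 2 = 1 / (32 * d)] while [a * b = 9 / (256 * d)]. *)
  apply: ler_expr_balanced => //.
  + by rewrite invr_ge0 ltW.
  + rewrite -(ler_pXn2r (n := 2)) ?nnegrE ?invr_ge0 ?(ltW s0) //; last by lra.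
    rewrite sE invf_ple ?posrE; lra.
  + rewrite sE -subr_ge0.
    have -> : 3 / 16 * (3 / 16 / d%:R) - (32 * d%:R)^-1 = 1 / 256 / d%:R :> R.
      by field; rewrite gt_eqF ?ltr0n.
    by rewrite !divr_ge0.
  + by rewrite !divr_ge0.
- lra.
- by rewrite dD3; lra.
- by rewrite cH; lra.
- by rewrite cH ddD dD3; lra.
Qed.

Theorem theorem2p3 (R : realType) (n d N : nat) (eps : R)
    (H : sgraph) (U1 U2 : {set H}) (G : sgraph) (V1 V2 : {set G})
    (bipH : bipartition U1 U2) (cardH : #|H| = n)
    (d_ge2 : (2 <= d)%N) (degH : (max_degree H <= d)%N)
    (eps_gt0 : 0 < eps)
    (bipG : bipartition V1 V2) (cardV1 : #|V1| = N) (cardV2 : #|V2| = N)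
    (N_ge : (16 * d)%:R * eps ^- d * n%:R <= N%:R)
    (edgesG : eps * N%:R ^+ 2 <= #|edges G|%:R) :
  (32 * d)%:R `^ (- (n%:R / 2)) * eps ^+ (d * n) * N%:R ^+ n
    <= #|labeled_copies H G|%:R :> R.
Proof.
(* The case [n = 0] is treated apart, since then [N] may be 0 and [D] need not be positive: the
   bound is 1, attained by the empty map. *)
have [n0|n0] := posnP n.
  have noH (x : H) : False by have := card0_eq (etrans cardH n0) x; rewrite inE.
  rewrite n0 mul0r oppr0 powRr0 muln0 !expr0 !mulr1 ler1n card_gt0.
  apply/set0Pn; exists [ffun x => False_rect _ (noH x)]; rewrite inE.
  by apply/andP; split; [apply/injectiveP => x; case: (noH x)
                        | apply/forallP => x; case: (noH x)].
(* Labeled copies do not refer to the parts, so [U1] and [U2] may be exchanged to make [U2] the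
   larger. *)
have bipH' : bipartition U2 U1.
  case: bipH => UT dU ad; split; first by rewrite setUC.
    by rewrite disjoint_sym.
  by move=> x y /ad[]; [right | left].
have [le|/ltnW le] := leqP #|U1| #|U2|.
  exact: (labeled_copies_large_U2 bipH cardH le d_ge2 degH eps_gt0 bipG).
exact: (labeled_copies_large_U2 bipH' cardH le d_ge2 degH eps_gt0 bipG).
Qed.
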